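(* For every $r\ge1$, let $P_r=\Phi^+(B_r)$ be the positive-root poset of type $B_r$ graded by $\operatorname{rk}(\alpha)=\operatorname{ht}(\alpha)-1$. Then $$\mathbb{H}_{P_r,\operatorname{rk}}(1,1)=\binom{2r-2}{r-1},\qquad \deg_t\mathbb{H}_{P_r,\operatorname{rk}}=r-1,$$ and the coefficient of the highest power of $t$ is $$[t^{r-1}]\,\mathbb{H}_{P_r,\operatorname{rk}}(q,t)=q^{(r-1)(r-2)}.$$ Moreover, for $0\le k\le r-1$, $$[t^k]\,\mathbb{H}_{P_r,\operatorname{rk}}(1,t)=\binom{r-1}{k}^{2}.$$
   Context: $q$-Zeta numerator: let $P$ be a finite graded poset with a unique maximum and rank function $\rho:P\to\{0,\dots,H\}$, where $H$ is the maximal rank. For $m\ge 0$ put $A_m(P,\rho;q)=\sum_{x_1\le\cdots\le x_m}q^{\rho(x_1)+\cdots+\rho(x_m)}$ (sum over weak chains in $P$; $A_0=1$). The numerator $\mathbb{H}_{P,\rho}(q,t)$ is the polynomial determined by $\sum_{m\ge 0}A_m(P,\rho;q)t^m=\mathbb{H}_{P,\rho}(q,t)/\prod_{a=0}^{H}(1-q^at)$. Type $B_r$ in $\mathbb{R}^r$ with standard basis $e_1,\dots,e_r$: simple roots $\alpha_i=e_i-e_{i+1}$ ($1\le i<r$), $\alpha_r=e_r$; positive roots $e_i-e_j$ ($i<j$), $e_i$, $e_i+e_j$ ($i<j$). Order: $\alpha\le\beta$ iff $\beta-\alpha$ is a nonnegative integer combination of simple roots. The height $\operatorname{ht}(\alpha)$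 is the sum of the simple-root coefficients of $\alpha$. *)

(* Defs.v *)
From HB Require Import structures.
From mathcomp Require Import all_boot all_order all_algebra.
From mathcomp Require Import boolp reals.
From mathcomp Require Import zify.
Set Implicit Arguments.
Unset Strict Implicit.
Unset Printing Implicit Defensive.
Import Order.TTheory GRing.Theory Num.Theory.
Local Open Scope ring_scope.

(* A polynomial in q and t is an element of {poly {poly int}}: the outer
   variable is t and the inner one is q. *)

Definition max_rank (T : finType) (rho : T -> nat) : nat :=
  (\max_(x : T) rho x)%N.

Definition chain_sum d (T : finPOrderType d) (rho : T -> nat) (m : nat) :
    {poly int} :=
  \sum_(s : m.-tuple T | sorted <=%O s) 'X^(\sum_(x <- s) rho x).

Definition numerator_denom (T : finType) (rho : T -> nat) :
    {poly {poly int}} :=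
  \prod_(a < (max_rank rho).+1) (1 - ('X^a)%:P * 'X).

(* The identity sum_m A_m t^m = N / prod_a (1 - q^a t) of formal power series
   in t, multiplied by the (invertible) denominator and read off coefficientwise
   through the Cauchy product. *)
Definition is_qzeta_numerator d (T : finPOrderType d) (rho : T -> nat)
    (N : {poly {poly int}}) : Prop :=
  forall n : nat,
    N`_n = \sum_(i < n.+1) (numerator_denom rho)`_i * chain_sum rho (n - i).

Lemma qzeta_numerator_uniq d (T : finPOrderType d) (rho : T -> nat)
    (N N' : {poly {poly int}}) :
  is_qzeta_numerator rho N -> is_qzeta_numerator rho N' -> N = N'.
Proof. by move=> hN hN'; apply/polyP => n; rewrite hN hN'. Qed.

Section RootPosetB.
Variables (R : realType) (r : nat).

(* Coordinates are numbered from 0, so that [std_vec k] is the usual e_{k+1} when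
   k < r. *)
Definition std_vec (k : nat) : 'rV[R]_r := \row_(j < r) (j == k :> nat)%:R.

Definition simple_root (i : 'I_r) : 'rV[R]_r :=
  if (i.+1 < r)%N then std_vec i - std_vec i.+1 else std_vec i.

Definition simple_roots : r.-tuple 'rV[R]_r := [tuple simple_root i | i < r].

Definition positive_roots : seq 'rV[R]_r :=
  [seq std_vec i - std_vec j | i <- iota 0 r, j <- index_iota i.+1 r]
  ++ [seq std_vec i | i <- iota 0 r]
  ++ [seq std_vec i + std_vec j | i <- iota 0 r, j <- index_iota i.+1 r].

Definition posroot : Type := seq_sub positive_roots.

Definition root_le (a b : posroot) : bool :=
  `[< exists c : 'I_r -> nat,
        val b - val a = \sum_(i < r) (c i)%:R *: simple_root i >].

Definition ht (a : posroot) : R := \sum_(i < r) coord simple_roots i (val a).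

(* Heights are positive integers; see [rkE]. *)
Definition rk (a : posroot) : nat := Num.truncn (ht a - 1).

Local Definition psum (k : 'I_r) (v : 'rV[R]_r) : R := \sum_(j < r | (j <= k)%N) v 0 j.

Local Lemma psum_e (k : 'I_r) (i : nat) : psum k (std_vec i) = (i <= k)%N%:R.
Proof.
rewrite /psum; under eq_bigr do rewrite mxE.
case: (leqP i k) => ik.
  have ir : (i < r)%N := leq_ltn_trans ik (ltn_ord k).
  rewrite (bigD1 (Ordinal ir)) //= eqxx big1 ?addr0 // => j /andP[_ ji].
  by rewrite (_ : (j == i :> nat) = false) //; apply: contra_neqF ji => /eqP ji; apply/val_inj.
rewrite big1 // => j jk.
by rewrite (_ : (j == i :> nat) = false) //; apply/eqP => ji; rewrite ji leqNgt ik in jk.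
Qed.

Local Lemma psumB k u v : psum k (u - v) = psum k u - psum k v.
Proof. by rewrite /psum -sumrB; apply: eq_bigr => j _; rewrite !mxE. Qed.

Local Lemma psum_simple k i : psum k (simple_root i) = (i == k)%:R.
Proof.
rewrite /simple_root; case: ifP => ir.
  rewrite psumB !psum_e -(inj_eq val_inj) /=.
  by case: (ltngtP i k) => _; rewrite ?subr0 ?subrr.
rewrite psum_e -(inj_eq val_inj) /= eqn_leq.
have -> : (k <= i)%N by have := ltn_ord k; have := ltn_ord i; lia.
by rewrite andbT.
Qed.

Local Lemma psum_comb k (c : 'I_r -> R) :
  psum k (\sum_(i < r) c i *: simple_root i) = c k.
Proof.
transitivity (\sum_(i < r) c i * psum k (simple_root i)).
  rewrite /psum; under eq_bigr do rewrite summxE.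
  rewrite exchange_big /=; apply: eq_bigr => i _.
  by rewrite mulr_sumr; apply: eq_bigr => j _; rewrite mxE.
rewrite (bigD1 k) //= psum_simple eqxx mulr1 big1 ?addr0 // => i ik.
by rewrite psum_simple (negPf ik) mulr0.
Qed.

Lemma simple_roots_free : free simple_roots.
Proof.
apply/freeP => c c0 k.
rewrite -(psum_comb k c) (_ : \sum_(i < r) _ = 0).
  by rewrite /psum big1 // => j _; rewrite mxE.
by rewrite -[RHS]c0; apply: eq_bigr => i _; rewrite -tnth_nth tnth_mktuple.
Qed.

Local Lemma simple_roots_basis : basis_of fullv simple_roots.
Proof.
by rewrite basisEfree simple_roots_free subvf dimvf size_tuple /dim /= mul1n leqnn.
Qed.

Local Lemma coord_simple k v : coord simple_roots k v = psum k v.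
Proof.
have hv := coord_basis simple_roots_basis (memvf v).
rewrite [in RHS]hv -[LHS](psum_comb k (fun i => coord simple_roots i v)).
by congr psum; apply: eq_bigr => i _; rewrite -tnth_nth tnth_mktuple.
Qed.

Local Lemma psum_pos v : v \in positive_roots ->
  exists c : 'I_r -> nat,
    (forall k, psum k v = (c k)%:R) /\ (0 < \sum_k c k)%N.
Proof.
have pos (c : 'I_r -> nat) (i : 'I_r) : (0 < c i)%N -> (0 < \sum_k c k)%N.
  by move=> ci; rewrite (bigD1 i) //= ltn_addr.
rewrite !mem_cat => /orP[|/orP[]].
- case/allpairsPdep => i [j [+ + ->]]; rewrite mem_iota mem_index_iota.
  move=> /andP[_ ir] /andP[ij jr].
  exists (fun k : 'I_r => (i <= k < j)%N : nat); split=> [k|].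
    rewrite psumB !psum_e; case: (leqP i k) => ik; case: (ltnP k j) => kj /=;
      by rewrite ?subr0 ?subrr //; lia.
  by apply: (pos _ (Ordinal ir)); rewrite /= leqnn ij.
- case/mapP => i; rewrite mem_iota => /andP[_ ir] ->.
  exists (fun k : 'I_r => (i <= k)%N : nat); split=> [k|]; first exact: psum_e.
  by apply: (pos _ (Ordinal ir)); rewrite /= leqnn.
- case/allpairsPdep => i [j [+ + ->]]; rewrite mem_iota mem_index_iota.
  move=> /andP[_ ir] /andP[ij jr].
  exists (fun k : 'I_r => (i <= k) + (j <= k))%N; split=> [k|].
    rewrite natrD -!psum_e /psum -big_split.
    by apply: eq_bigr => l _; rewrite !mxE.
  by apply: (pos _ (Ordinal ir)); rewrite /= leqnn.
Qed.

Lemma rkE (a : posroot) : (rk a)%:R = ht a - 1.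
Proof.
have [c [hc c0]] := psum_pos (valP a).
rewrite /rk (_ : ht a - 1 = (\sum_k c k).-1%:R) ?natrK //.
rewrite -subn1 natrB // natr_sum /ht; congr (_ - _).
by apply: eq_bigr => k _; rewrite coord_simple hc.
Qed.

HB.instance Definition _ := Finite.on posroot.

Local Lemma root_le_refl : reflexive root_le.
Proof.
move=> a; apply/asboolP; exists (fun=> 0%N).
by rewrite subrr big1 // => i _; rewrite scale0r.
Qed.

Local Lemma root_le_trans : transitive root_le.
Proof.
move=> b a c /asboolP[f hf] /asboolP[g hg].
apply/asboolP; exists (fun i => f i + g i)%N.
rewrite -[val c](subrK (val b)) -addrA hf hg -big_split /=.
by apply: eq_bigr => i _; rewrite natrD scalerDl addrC.
Qed.

Local Lemma root_le_anti : antisymmetric root_le.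
Proof.
move=> a b /andP[/asboolP[f hf] /asboolP[g hg]]; apply/val_inj/eqP.
rewrite eq_sym -subr_eq0 hf big1 // => k _.
suff -> : f k = 0%N by rewrite scale0r.
have : (f k)%:R + (g k)%:R = 0 :> R.
  rewrite -(psum_comb k (fun i => (f i)%:R)) -(psum_comb k (fun i => (g i)%:R)).
  by rewrite -hf -hg !psumB addrA subrK subrr.
by move/eqP; rewrite -natrD pnatr_eq0 addn_eq0 => /andP[/eqP].
Qed.

HB.instance Definition _ := Order.Le_isPOrder.Build (Order.Disp tt tt) posroot
  root_le_refl root_le_anti root_le_trans.

End RootPosetB.

(* Main.v *)
(* Index the negatives of e_0, ..., e_(r-1) from the right, so that every positive
   root becomes a difference e_d - e_b of height b - d; with n = r - 1 and
   u = 2n + 1 - b the poset is the trapezoid d <= u, u + d <= 2n with rank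
   2n - u - d and the reverse product order. The elements above (u, d) then form a
   two-dimensional staircase, so inclusion-exclusion over the upper covers shows that
   the numerators M(u, d) of the q-zeta series of the principal filters satisfy
     M(u, d) = M(u-1, d) + M(u, d-1) - (1 - q^(rank + 1) t) M(u-1, d-1)  (d < u),
     M(u, u) = M(u, u-1),  M(u, 0) = 1.
   At q = 1 this counts ballot words by valleys, for which reflection gives a
   difference of products of binomials. A last inclusion-exclusion over the minimal
   roots writes the full numerator as a sum of the M(2n-d, d) and M(2n-1-d, d), whose
   coefficients at q = 1 telescope to the squares of binomials. *)

Require Import Defs.
From mathcomp Require Import all_boot all_order all_algebra.
From mathcomp Require Import boolp reals.
From mathcomp Require Import zify ring.
Set Implicit Arguments.
Unset Strict Implicit.
Unset Printing Implicit Defensive.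
Import Order.TTheory GRing.Theory Num.Theory.
Local Open Scope ring_scope.

(* The coefficient of [t^n] in the product of [p] with the power series of
   coefficients [f]. *)
Definition cauchy (A : comNzRingType) (p : {poly A}) (f : nat -> A) (n : nat) : A :=
  \sum_(i < n.+1) p`_i * f (n - i)%N.

(** * Products of a polynomial with a formal power series *)

Section Cauchy.
Variable A : comNzRingType.
Implicit Types (p q : {poly A}) (f g h : nat -> A).

(** A coefficient sees only finitely many terms of the series, so truncation reduces the
    associativity in [cauchyM] to that of polynomials. *)
Lemma cauchy_coef p f K n : (n < K)%N ->
  cauchy p f n = (p * \poly_(m < K) f m)`_n.
Proof.
move=> nK; rewrite coefM; apply: eq_bigr => i _.
by rewrite coef_poly (leq_ltn_trans (leq_subr i n) nK).
Qed.

Lemma eq_cauchy p f g : f =1 g -> cauchy p f =1 cauchy p g.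
Proof. by move=> fg n; apply: eq_bigr => i _; rewrite fg. Qed.

Lemma cauchyM p q f n : cauchy (p * q) f n = cauchy p (cauchy q f) n.
Proof.
rewrite (@cauchy_coef _ _ n.+1) // -mulrA coefM; apply: eq_bigr => i _.
by rewrite (@cauchy_coef _ _ n.+1) // ltnS leq_subr.
Qed.

Lemma cauchyD p f g n :
  cauchy p (fun m => f m + g m) n = cauchy p f n + cauchy p g n.
Proof. by rewrite -big_split; apply: eq_bigr => i _; rewrite mulrDr. Qed.

Lemma cauchyB p f g n :
  cauchy p (fun m => f m - g m) n = cauchy p f n - cauchy p g n.
Proof. by rewrite -sumrB; apply: eq_bigr => i _; rewrite mulrBr. Qed.

Lemma cauchy_sum p (I : finType) (F : I -> nat -> A) n :
  cauchy p (fun m => \sum_i F i m) n = \sum_i cauchy p (F i) n.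
Proof.
rewrite exchange_big; apply: eq_bigr => i _.
by rewrite mulr_sumr.
Qed.

Lemma cauchy_linear0 (c : A) f : cauchy (1 - c%:P * 'X) f 0%N = f 0%N.
Proof.
by rewrite /cauchy big_ord1 coefB coef1 coefMX subr0 mul1r.
Qed.

Lemma cauchy_linearS (c : A) f n :
  cauchy (1 - c%:P * 'X) f n.+1 = f n.+1 - c * f n.
Proof.
rewrite /cauchy !big_ord_recl big1 => [|i _].
  by rewrite !coefB !coef1 !coefMX !coefC /= subr0 mul1r addr0 sub0r mulNr subn1.
by rewrite coefB coef1 coefMX coefC subrr mul0r.
Qed.

End Cauchy.

(** * Numerators of the principal filters *)

Section Region.
Variable H : nat.

(* The pairs [(i, j)] with [j <= i] and [i + j <= H] carry the rank [H - i - j]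
   and the reverse of the product order. *)
Fixpoint up_chains (m u d : nat) : {poly int} :=
  if m is m'.+1 then
    \sum_(j < d.+1) \sum_(j <= i < u.+1) 'X^(H - i - j) * up_chains m' i j
  else 1.

(** The filter of an element of rank [a] only meets the ranks from [a] to [H]. *)
Definition denom_from (a : nat) : {poly {poly int}} :=
  \prod_(a <= b < H.+1) (1 - ('X^b)%:P * 'X).

Definition up_numer (u d : nat) : nat -> {poly int} :=
  cauchy (denom_from (H - u - d)) (fun m => up_chains m u d).

Lemma denom_from_recl a : (a <= H)%N ->
  denom_from a = denom_from a.+1 * (1 - ('X^a)%:P * 'X).
Proof. by move=> aH; rewrite /denom_from big_ltn // mulrC. Qed.

Lemma up_chains_corner m : up_chains m.+1 0 0 = 'X^H * up_chains m 0 0.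
Proof. by rewrite /= big_ord1 big_nat1 !subn0. Qed.

Lemma up_chains_edge m u : up_chains m.+1 u.+1 0 =
  'X^(H - u.+1) * up_chains m u.+1 0 + up_chains m.+1 u 0.
Proof. by rewrite /= !big_ord1 /= big_nat_recr //= subn0 addrC. Qed.

Lemma up_chains_diag m u : up_chains m.+1 u.+1 u.+1 =
  'X^(H - u.+1 - u.+1) * up_chains m u.+1 u.+1 + up_chains m.+1 u.+1 u.
Proof. by rewrite /= [LHS]big_ord_recr /= big_nat1 addrC. Qed.

(** A chain that does not start at the bottom of the filter lies above one of its two upper covers;
    the filters of these meet in that of [(u, d)]. *)
Lemma up_chains_inner m u d : (d < u)%N -> up_chains m.+1 u.+1 d.+1 =
  'X^(H - u.+1 - d.+1) * up_chains m u.+1 d.+1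
  + (up_chains m.+1 u d.+1 + up_chains m.+1 u.+1 d - up_chains m.+1 u d).
Proof.
move=> du /=; rewrite [LHS]big_ord_recr [X in _ + (X + _ - _)]big_ord_recr /=.
rewrite [X in _ + X = _]big_nat_recr; last exact: leqW.
by rewrite /=; ring.
Qed.

Lemma up_numer_corner k : up_numer 0 0 k = (k == 0%N)%:R.
Proof.
rewrite /up_numer !subn0 denom_from_recl // /denom_from big_geq // mul1r.
case: k => [|k]; first by rewrite cauchy_linear0.
by rewrite cauchy_linearS up_chains_corner subrr.
Qed.

(** The lowest factor of the denominator cancels the chains that start at [(u, d)] itself; [g]
    counts the others. *)
Lemma up_numer_step u d g :
  (u + d <= H)%N -> g 0%N = 1 ->
  (forall m, up_chains m.+1 u d = 'X^(H - u - d) * up_chains m u d + g m.+1) ->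
  up_numer u d =1 cauchy (denom_from (H - u - d).+1) g.
Proof.
move=> udH g0 gS n; rewrite /up_numer denom_from_recl; last by lia.
rewrite cauchyM; apply: eq_cauchy => -[|m]; first by rewrite cauchy_linear0 g0.
by rewrite cauchy_linearS gS addrC addKr.
Qed.

Lemma up_numer_edge u k : (u <= H)%N -> up_numer u 0 k = (k == 0%N)%:R.
Proof.
elim: u k => [|u IHu] k uH; first exact: up_numer_corner.
rewrite (@up_numer_step _ _ (fun m => up_chains m u 0)) ?addn0 //.
  rewrite -IHu; last exact: ltnW.
  by rewrite /up_numer !subn0 subnSK.
by move=> m; rewrite up_chains_edge subn0.
Qed.

Lemma up_numer_diag u : (u.+1 + u.+1 <= H)%N ->
  up_numer u.+1 u.+1 =1 up_numer u.+1 u.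
Proof.
move=> uH k; rewrite (@up_numer_step _ _ (fun m => up_chains m u.+1 u)) //.
  by rewrite /up_numer; congr (cauchy (denom_from _) _ _); lia.
by move=> m; rewrite up_chains_diag.
Qed.

Lemma up_numer_inner u d k : (d < u)%N -> (u.+1 + d.+1 <= H)%N ->
  up_numer u.+1 d.+1 k = up_numer u d.+1 k + up_numer u.+1 d k
    - cauchy (1 - ('X^(H - u.+1 - d))%:P * 'X) (up_numer u d) k.
Proof.
move=> du udH.
rewrite (@up_numer_step _ _ (fun m => up_chains m u d.+1 + up_chains m u.+1 d
    - up_chains m u d)) //; last 2 first.
- by rewrite addrK.
- by move=> m; rewrite up_chains_inner.
rewrite cauchyB cauchyD; congr (_ + _ - _).
- by rewrite /up_numer; congr (cauchy (denom_from _) _ _); lia.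
- by rewrite /up_numer; congr (cauchy (denom_from _) _ _); lia.
(* [(u, d)] lies two ranks above [(u.+1, d.+1)], so its own denominator lacks one factor of the
   common one; that factor stays outside. *)
rewrite -cauchyM denom_from_recl; last by lia.
rewrite mulrC (_ : (H - u.+1 - d.+1).+1 = H - u.+1 - d)%N; last by lia.
by congr (cauchy (_ * denom_from _) _ _); lia.
Qed.

Lemma up_numer_inner0 u d : (d < u)%N -> (u.+1 + d.+1 <= H)%N ->
  up_numer u.+1 d.+1 0 =
  up_numer u d.+1 0 + up_numer u.+1 d 0 - up_numer u d 0.
Proof. by move=> du udH; rewrite up_numer_inner // cauchy_linear0. Qed.

Lemma up_numer_innerS u d k : (d < u)%N -> (u.+1 + d.+1 <= H)%N ->
  up_numer u.+1 d.+1 k.+1 =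
  up_numer u d.+1 k.+1 + up_numer u.+1 d k.+1 - up_numer u d k.+1
  + 'X^(H - u.+1 - d) * up_numer u d k.
Proof.
by move=> du udH; rewrite up_numer_inner // cauchy_linearS opprB addrCA addrC.
Qed.

Lemma region_ind (P : nat -> nat -> Prop) :
  (forall u, (u <= H)%N -> P u 0%N) ->
  (forall u, (u.+1 + u.+1 <= H)%N -> P u.+1 u -> P u.+1 u.+1) ->
  (forall u d, (d < u)%N -> (u.+1 + d.+1 <= H)%N ->
     P u d.+1 -> P u.+1 d -> P u d -> P u.+1 d.+1) ->
  forall u d, (d <= u)%N -> (u + d <= H)%N -> P u d.
Proof.
move=> Pedge Pdiag Pinner; elim=> [|u IHu] d.
  by case: d => // _ _; exact: Pedge.
elim: d => [|d IHd] du udH; first by apply: Pedge; rewrite addn0 in udH.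
move: du; rewrite ltnS leq_eqVlt => /predU1P[du|du].
  by subst d; apply: Pdiag => //; apply: IHd; lia.
by apply: Pinner => //; [apply: IHu|apply: IHd|apply: IHu]; lia.
Qed.

(** In the recursion only the term with a factor [t] can raise the degree, and it lowers the second
    index by one. *)
Lemma up_numer_gt u d k : (d <= u)%N -> (u + d <= H)%N -> (d < k)%N ->
  up_numer u d k = 0.
Proof.
move=> du udH; move: u d du udH k.
apply: region_ind => [u uH|u uH IH|u d du udH IH1 IH2 IH3] k.
- by rewrite up_numer_edge // lt0n => /negPf ->.
- by move=> uk; rewrite up_numer_diag // IH // ltnW.
case: k => // k dk.
rewrite up_numer_innerS // IH1 // (IH2 _ (ltnW dk)) (IH3 _ dk) (IH3 _ (ltnW dk)).
by rewrite mulr0 !addr0 subr0.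
Qed.

(** In top degree only the term with a factor [t] survives the degree bound, so the powers of [q]
    multiply up. *)
Lemma up_numer_top d : (d.*2 < H)%N ->
  up_numer d.+1 d d = 'X^(d * (H - d.+1)).
Proof.
elim: d => [|d IHd] dH; first by rewrite up_numer_edge.
rewrite up_numer_innerS //; last by lia.
rewrite IHd; last by lia.
rewrite [X in X + _ - _]up_numer_diag; last by lia.
rewrite !(@up_numer_gt _ d) //; [|lia..].
rewrite addr0 subr0 add0r -exprD; congr ('X^_).
nia.
Qed.

(* The number of ballot words with [u] letters U and [d] letters D (every prefix
   has at least as many U as D) and [k] factors DU. *)
Definition ballot_valleys (u d k : nat) : int :=
  ('C(u, k) * 'C(d, k))%N%:R
  - (if k is j.+1 then 'C(u.-1, j) * 'C(d.+1, j.+2) else 0)%N%:R.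

(** At [q = 1] both sides obey the same recursion, by Pascal's rule. *)
Lemma up_numer_at1 u d k : (d <= u)%N -> (u + d <= H)%N ->
  (up_numer u d k).[1] = ballot_valleys u d k.
Proof.
move=> du udH; move: u d du udH k.
apply: region_ind => [u uH|u uH IH|u d du udH IH1 IH2 IH3] k.
- rewrite up_numer_edge // /ballot_valleys.
  case: k => [|k]; first by rewrite hornerC !bin0.
  by rewrite horner0 (@bin_small 0) // (@bin_small 1) // !muln0 subrr.
- rewrite up_numer_diag // IH /ballot_valleys.
  case: k => [|k] /=; first by rewrite !bin0.
  by rewrite (binS u.+1 k.+1) (binS u k) !(natrM, natrD); ring.
case: k => [|k].
  by rewrite up_numer_inner0 // !hornerE IH1 IH2 IH3 /ballot_valleys !bin0.
rewrite up_numer_innerS // !hornerE IH1 IH2 !IH3 ?expr1n ?mul1r /ballot_valleys.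
(* Here [d < u] makes [u] a successor, so that the [u.-1] of [ballot_valleys] reduces. *)
case: u du {udH IH1 IH2 IH3} => // u _ /=.
rewrite (binS u.+1 k) (binS d.+1 k.+1) (binS d k).
case: k => [|k]; first by rewrite !bin0 !(natrM, natrD); ring.
by rewrite (binS u k) !(natrM, natrD); ring.
Qed.

End Region.

(** With [H - d = u.+2], the right-hand side is the increment from [d] to [d.+1] of
    ['C(H - d, k.+1) * 'C(d, k.+1)]. *)
Lemma ballot_valleys_diff u d k :
  ballot_valleys u.+1 d.+1 k.+1 - ballot_valleys u.+1 d k.+1
    + ballot_valleys u.+1 d k
  = ('C(u.+1, k.+1) * 'C(d.+1, k.+1))%N%:R
    - ('C(u.+2, k.+1) * 'C(d, k.+1))%N%:R.
Proof.
rewrite /ballot_valleys /= (binS u.+1 k) (binS d.+1 k.+1) (binS d k).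
case: k => [|k]; first by rewrite !bin0 !(natrM, natrD); ring.
by rewrite (binS u k) !(natrM, natrD); ring.
Qed.

(** * The numerator of the whole trapezoid *)

Section Trapezoid.
Variable n : nat.
Let H := (n + n)%N.

Definition trap_chains (m : nat) : {poly int} :=
  if m is m'.+1 then
    \sum_(j < n.+1) \sum_(j <= i < (H - j).+1) 'X^(H - i - j) * up_chains H m' i j
  else 1.

Definition trap_numer : nat -> {poly int} := cauchy (denom_from H 0) trap_chains.

(** The filter of [(H - d.+1, d.+1)] exceeds that of [(H - d.+1, d)] by exactly the row [j = d.+1],
    so the differences rebuild the trapezoid row by row. *)
Lemma trap_chainsE m : trap_chains m =
  \sum_(d < n.+1) up_chains H m (H - d) d
  - \sum_(d < n) up_chains H m (H - d.+1) d.
Proof.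
case: m => [|m].
  by rewrite /= !sumr_const !card_ord mulrSr addrC addKr.
rewrite [trap_chains _]big_ord_recl [in RHS]big_ord_recl -addrA -sumrB.
congr (_ + _); first by rewrite [RHS]big_ord1.
by apply: eq_bigr => d _; rewrite /= big_ord_recr addrC addKr.
Qed.

Lemma trap_numerE k : trap_numer k =
  \sum_(d < n.+1) up_numer H (H - d) d k
  - \sum_(d < n) cauchy (1 - ('X^0)%:P * 'X) (up_numer H (H - d.+1) d) k.
Proof.
rewrite /trap_numer (eq_cauchy _ trap_chainsE) cauchyB !cauchy_sum.
congr (_ - _); apply: eq_bigr => d _.
  by congr (cauchy (denom_from _ _) _ _); have := ltn_ord d; rewrite /H; lia.
(* The overlaps have bottom rank 1, so the factor of rank 0 is left over. *)
rewrite denom_from_recl // mulrC cauchyM; congr cauchy.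
by congr (cauchy (denom_from _ _)); have := ltn_ord d; rewrite /H; lia.
Qed.

Lemma trap_numer0 : trap_numer 0 = 1.
Proof.
rewrite /trap_numer /cauchy big_ord1 mulr1 -horner_coef0 horner_prod.
by rewrite big1_seq // => b _; rewrite !hornerE subr0.
Qed.

Lemma trap_numerS k : trap_numer k.+1 =
  \sum_(d < n.+1) up_numer H (H - d) d k.+1
  - \sum_(d < n) up_numer H (H - d.+1) d k.+1
  + \sum_(d < n) up_numer H (H - d.+1) d k.
Proof.
rewrite trap_numerE -addrA; congr (_ + _).
under eq_bigr do rewrite cauchy_linearS expr0 mul1r.
by rewrite sumrB opprB addrC.
Qed.

Lemma trap_numer_ge k : (n <= k.+1)%N ->
  trap_numer k.+1 = \sum_(d < n | (k <= d)%N) up_numer H (H - d.+1) d k.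
Proof.
move=> nk; rewrite trap_numerS.
rewrite [X in X - _ + _]big1 => [|d _].
  rewrite [X in _ - X + _]big1 => [|d _].
    rewrite subrr add0r [RHS]big_mkcond; apply: eq_bigr => d _.
    case: leqP => // dk.
    by rewrite up_numer_gt // /H; have := ltn_ord d; lia.
  by rewrite up_numer_gt // /H; have := ltn_ord d; lia.
(* For [d = n] the degree bound [n] may equal [k.+1]; the diagonal identity improves it to
   [n - 1]. *)
have := ltn_ord d; rewrite ltnS leq_eqVlt => /predU1P[-> | dn].
  rewrite /H addnK; case: n nk => [|n'] nk; first by rewrite up_numer_gt.
  by rewrite up_numer_diag // up_numer_gt //; lia.
by rewrite up_numer_gt // /H; lia.
Qed.

Lemma trap_numer_gt k : (n < k)%N -> trap_numer k = 0.
Proof.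
case: k => [//|k] nk; rewrite (trap_numer_ge (ltnW nk)); apply: big_pred0 => d.
by apply/negbTE; rewrite -ltnNge (leq_trans (ltn_ord d)).
Qed.

Lemma trap_numer_at1 k : (trap_numer k).[1] = ('C(n, k) ^ 2)%N%:R.
Proof.
case: k => [|k]; first by rewrite trap_numer0 hornerC bin0.
rewrite trap_numerS !hornerE !horner_sum big_ord_recl /=.
rewrite up_numer_at1 ?subn0 ?addn0 //.
rewrite {1}/ballot_valleys (@bin_small 0) // (@bin_small 1) // !muln0 subrr add0r.
rewrite -sumrB -big_split /=.
(* After shifting the first sum by one, the summands are increments of [g], with [g 0 = 0] and [g n]
   the wanted square because [H - n = n]. *)
pose g d : int := ('C(H - d, k.+1) * 'C(d, k.+1))%N%:R.
transitivity (\sum_(0 <= d < n) (g d.+1 - g d)).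
  rewrite big_mkord; apply: eq_bigr => d _; have dn := ltn_ord d.
  rewrite !up_numer_at1 /bump /=; try by rewrite /H; lia.
  have [u Hu] : exists u, (H - d = u.+2)%N by exists (H - d - 2)%N; rewrite /H; lia.
  rewrite /g Hu (_ : H - d.+1 = u.+1)%N; last by lia.
  exact: ballot_valleys_diff.
rewrite telescope_sumr // {2}/g bin0n muln0 subr0 /g addnK.
by rewrite -mulnn.
Qed.

End Trapezoid.

Lemma trap_numer_top n : trap_numer n n = 'X^(n * n.-1).
Proof.
case: n => [|n]; first by rewrite trap_numer0.
rewrite trap_numer_ge // big_mkcond big_ord_recr /= leqnn big1 => [|d _].
  rewrite add0r (_ : n.+1 + n.+1 - n.+1 = n.+1)%N; last by lia.
  rewrite up_numer_top; last by lia.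
  by congr ('X^_); nia.
by rewrite leqNgt ltn_ord.
Qed.

(** * Chain sums split by their first element *)

Lemma big_tuple_cons (A : nmodType) (T : finType) m (P : pred (seq T))
    (F : seq T -> A) :
  \sum_(s : m.+1.-tuple T | P s) F s =
  \sum_(x : T) \sum_(s : m.-tuple T | P (x :: s)) F (x :: s).
Proof.
rewrite (pair_big_dep xpredT (fun x (s : m.-tuple T) => P (x :: s))
  (fun x (s : m.-tuple T) => F (x :: s))) /=.
apply: (reindex (fun p : T * m.-tuple T => [tuple of p.1 :: p.2])).
exists (fun s => (thead s, [tuple of behead s])) => [[x s]|s] _ /=.
  by rewrite theadE; congr pair; apply: val_inj.
by rewrite -tuple_eta.
Qed.

Section ChainSum.
Context d (T : finPOrderType d) (rho : T -> nat).

Definition chains_above (m : nat) (x : T) : {poly int} :=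
  \sum_(s : m.-tuple T | path <=%O x s) 'X^(\sum_(y <- s) rho y).

Lemma chains_above0 x : chains_above 0 x = 1.
Proof.
rewrite /chains_above (big_pred1 [tuple]) => [|[[|y s] sz]] //.
by rewrite big_nil.
Qed.

Lemma chain_sum0 : chain_sum rho 0 = 1.
Proof.
rewrite /chain_sum (big_pred1 [tuple]) => [|[[|y s] sz]] //.
by rewrite big_nil.
Qed.

Lemma chain_sumS m :
  chain_sum rho m.+1 = \sum_x 'X^(rho x) * chains_above m x.
Proof.
rewrite /chain_sum (big_tuple_cons _ (sorted <=%O) (fun s => 'X^(\sum_(x <- s) rho x))).
apply: eq_bigr => x _; rewrite mulr_sumr; apply: eq_bigr => s _.
by rewrite big_cons exprD.
Qed.

Lemma chains_aboveS m x :
  chains_above m.+1 x = \sum_(y | (x <= y)%O) 'X^(rho y) * chains_above m y.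
Proof.
rewrite /chains_above (big_tuple_cons _ (path <=%O x)
  (fun s => 'X^(\sum_(y <- s) rho y))).
rewrite [RHS]big_mkcond; apply: eq_bigr => y _ /=; case: ifP => xy.
  by rewrite mulr_sumr; apply: eq_bigr => s _; rewrite big_cons exprD.
by rewrite big_pred0.
Qed.

End ChainSum.

(** * The positive roots of type B as a trapezoid *)

Lemma positive_rootsP (R : realType) (r : nat) (v : 'rV[R]_r) :
  v \in positive_roots R r <->
  [\/ exists i j, (i < j < r)%N /\ v = std_vec R r i - std_vec R r j,
      exists2 i, (i < r)%N & v = std_vec R r i |
      exists i j, (i < j < r)%N /\ v = std_vec R r i + std_vec R r j].
Proof.
rewrite !mem_cat; split=> [/orP[|/orP[]]|[]].
- case/allpairsPdep => i [j [_ + ->]]; rewrite mem_index_iota => ij.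
  by constructor 1; exists i, j.
- case/mapP => i; rewrite mem_iota => /andP[_ ir] ->.
  by constructor 2; exists i.
- case/allpairsPdep => i [j [_ + ->]]; rewrite mem_index_iota => ij.
  by constructor 3; exists i, j.
- move=> [i [j [ij ->]]]; apply/orP; left; apply/allpairsPdep; exists i, j.
  by rewrite mem_iota mem_index_iota ij; split=> //; lia.
- by move=> [i ir ->]; apply/or3P; constructor 2; rewrite map_f // mem_iota.
move=> [i [j [ij ->]]]; apply/or3P; constructor 3; apply/allpairsPdep; exists i, j.
by rewrite mem_iota mem_index_iota ij; split=> //; lia.
Qed.

Section RootsB.
Variables (R : realType) (n : nat).
Let H := (n + n)%N.
Notation r := n.+1.

Definition region (u d : nat) := (d <= u)%N && (u + d <= H)%N.

(* Writing [e_(H + 2 - k)] for [- e_k] and [e_(n + 1)] for [0], the root of index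
   [(u, d)] is [e_d - e_(H + 1 - u)]. *)
Definition trap_root (u d : nat) : 'rV[R]_r :=
  if (u <= n)%N then std_vec R r d + std_vec R r u.+1
  else std_vec R r d - std_vec R r (H.+1 - u).

(** The coefficient of the [k]-th simple root, computed as a partial sum of coordinates; in the
    region the subtraction is never truncated. *)
Definition trap_coef (u d k : nat) : nat :=
  if (u <= n)%N then ((d <= k) + (u < k))%N else ((d <= k) - (H - u < k))%N.

(** For [k = n.+1] this makes the short roots the case [u = n] of [trap_root]. *)
Lemma std_vec_out k : (r <= k)%N -> std_vec R r k = 0.
Proof.
move=> rk; apply/rowP => j; rewrite !mxE.
by have := ltn_ord j; case: eqP => //; lia.
Qed.

Lemma psum_trap_root u d (k : 'I_r) : region u d ->
  Defs.psum k (trap_root u d) = (trap_coef u d k)%:R.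
Proof.
case/andP => du udH; rewrite /trap_root /trap_coef; case: (leqP u n) => un.
  rewrite (natrD R) -!(Defs.psum_e R k) /Defs.psum -big_split.
  by apply: eq_bigr => l _; rewrite !mxE.
rewrite Defs.psumB !Defs.psum_e (_ : (H.+1 - u <= k) = (H - u < k))%N; last by lia.
by rewrite natrB //; lia.
Qed.

Lemma trap_coef_le u d u' d' : region u d -> region u' d' ->
  (forall k : 'I_r, (trap_coef u d k <= trap_coef u' d' k)%N)
  <-> (u' <= u)%N && (d' <= d)%N.
Proof.
rewrite /region /trap_coef /H => h h'; split => [le|le k]; last first.
  by case: (leqP u n) => un; case: (leqP u' n) => u'n; lia.
have lek k : (k <= n)%N -> (trap_coef u d k <= trap_coef u' d' k)%N.
  by move=> kn; apply: (le (Ordinal (kn : (k < r)%N))).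
rewrite /trap_coef /H in lek; apply/andP; split; last first.
  (* The coefficient of [(u, d)] is already nonzero at [k = d]. *)
  have := lek d; case: (leqP u n) => un; case: (leqP u' n) => u'n; lia.
(* The test index is where the coefficient first reaches 2, [k = u.+1], if [u < n], and where it is
   last nonzero, [k = H - u], otherwise. *)
case: (leqP u' n) lek => u'n lek; case: (ltngtP u n) lek => un lek.
- by have := lek u.+1; lia.
- by lia.
- by lia.
- by have := lek u.+1; lia.
- by have := lek (n + n - u)%N; lia.
- by have := lek n; lia.
Qed.

Lemma trap_root_inj u d u' d' : region u d -> region u' d' ->
  trap_root u d = trap_root u' d' -> (u, d) = (u', d').
Proof.
move=> h h' e.
have ek (k : 'I_r) : trap_coef u d k = trap_coef u' d' k.
  by apply/eqP; rewrite -(eqr_nat R) -!psum_trap_root // e.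
have /(trap_coef_le h h') le :
    forall k : 'I_r, (trap_coef u d k <= trap_coef u' d' k)%N.
  by move=> k; rewrite ek.
have /(trap_coef_le h' h) ge :
    forall k : 'I_r, (trap_coef u' d' k <= trap_coef u d k)%N.
  by move=> k; rewrite ek.
by congr pair; lia.
Qed.

Lemma mem_positive_rootsP v :
  reflect (exists u d, region u d /\ v = trap_root u d) (v \in positive_roots R r).
Proof.
apply: (iffP idP) => [/positive_rootsP[]|].
- move=> [i [j [ij ->]]]; exists (H.+1 - j)%N, i.
  rewrite /region /trap_root /H; split; first by lia.
  by rewrite leqNgt (_ : n < _)%N ?subKn //; lia.
- move=> [i ir ->]; exists n, i.
  rewrite /region /trap_root /H leqnn; split; first by lia.
  by rewrite (@std_vec_out n.+1) // addr0.
- move=> [i [j [ij ->]]]; exists j.-1, i.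
  rewrite /region /trap_root /H; split; first by lia.
  by rewrite (_ : j.-1 <= n)%N ?prednK //; lia.
move=> [u [d [/andP[du udH] ->]]]; rewrite /H in udH.
apply/positive_rootsP; rewrite /trap_root /H; case: (ltngtP u n) => un.
- by constructor 3; exists d, u.+1; split=> //; lia.
- by constructor 1; exists d, ((n + n).+1 - u)%N; split=> //; lia.
by constructor 2; exists d; [lia|rewrite un (@std_vec_out n.+1) // addr0].
Qed.

Lemma trap_root_mem u d : region u d -> trap_root u d \in positive_roots R r.
Proof. by move=> h; apply/mem_positive_rootsP; exists u, d. Qed.

(** Total in [u] and [d], so that sums over naturals can use it; the root of index [(0, 0)] is the
    default. *)
Definition trap_posroot (u d : nat) : posroot R r :=
  insubd (SeqSub (trap_root_mem (isT : region 0 0))) (trap_root u d).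

Lemma val_trap_posroot u d : region u d -> val (trap_posroot u d) = trap_root u d.
Proof. by move=> h; rewrite val_insubd trap_root_mem. Qed.

Lemma sum_simple_roots (v : 'rV[R]_r) :
  v = \sum_(i < r) Defs.psum i v *: simple_root R i.
Proof.
rewrite [LHS](coord_basis (Defs.simple_roots_basis R r) (memvf v)).
by apply: eq_bigr => i _; rewrite Defs.coord_simple -tnth_nth tnth_mktuple.
Qed.

Lemma trap_posroot_le u d u' d' : region u d -> region u' d' ->
  (trap_posroot u d <= trap_posroot u' d')%O = (u' <= u)%N && (d' <= d)%N.
Proof.
move=> h h'; apply/idP/idP.
  case/asboolP => c; rewrite !val_trap_posroot // => e.
  apply/(trap_coef_le h h') => k; rewrite -(ler_nat R) -!psum_trap_root //.
  by rewrite -subr_ge0 -Defs.psumB e (Defs.psum_comb k (fun i => (c i)%:R)) ler0n.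
move/(trap_coef_le h h') => le; apply/asboolP.
exists (fun k => trap_coef u' d' k - trap_coef u d k)%N.
rewrite !val_trap_posroot // [LHS]sum_simple_roots; apply: eq_bigr => k _.
by rewrite Defs.psumB !psum_trap_root // natrB.
Qed.

Lemma sum_ord_ltn m a : (\sum_(k < m) (a <= k) = m - a)%N.
Proof.
elim: m => [|m IHm]; first by rewrite big_ord0.
by rewrite big_ord_recr /= IHm; lia.
Qed.

Lemma rk_trap_posroot u d : region u d -> rk (trap_posroot u d) = (H - u - d)%N.
Proof.
move=> h; apply/eqP; rewrite -(eqr_nat R) rkE /ht val_trap_posroot //.
under eq_bigr do rewrite Defs.coord_simple psum_trap_root //.
rewrite -natr_sum -[1]/(1%:R) (_ : \sum_(i < r) _ = (H - u - d).+1)%N; last first.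
  case/andP: h => du udH; rewrite /trap_coef; case: (leqP u n) => un.
    by rewrite big_split /= !sum_ord_ltn /H; lia.
  rewrite sumnB; last by move=> k _; lia.
  by rewrite !sum_ord_ltn; rewrite /H in udH *; lia.
by rewrite -natrB // subn1.
Qed.

Lemma sum_posroot (A : nmodType) (P : pred (posroot R r)) (F : posroot R r -> A) :
  \sum_(x | P x) F x =
  \sum_(j < r) \sum_(j <= i < (H - j).+1 | P (trap_posroot i j))
     F (trap_posroot i j).
Proof.
pose L := [seq (i, j) | j <- iota 0 r, i <- index_iota j (H - j).+1].
have LP p : (p \in L) = region p.1 p.2.
  case: p => u d; apply/allpairsPdep/idP => [[j [i [+ + [-> ->]]]]|/andP[du udH]].
    by rewrite mem_iota mem_index_iota /region /H /=; lia.
  exists d, u; rewrite mem_iota mem_index_iota; split=> //.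
    by rewrite /H /= in du udH *; lia.
  by rewrite /= in du udH *; lia.
have Lu : uniq L.
  apply: allpairs_uniq_dep; first exact: iota_uniq.
    by move=> j _; apply: iota_uniq.
  by move=> [j i] [j' i'] _ _ [-> ->].
have perm : perm_eq (index_enum (posroot R r)) [seq trap_posroot p.1 p.2 | p <- L].
  apply: uniq_perm; first exact: index_enum_uniq.
    rewrite map_inj_in_uniq // => -[u d] [u' d']; rewrite !LP /= => h h' e.
    by apply: trap_root_inj => //; rewrite -!val_trap_posroot // e.
  move=> x; rewrite mem_index_enum; apply/esym/mapP.
  have /mem_positive_rootsP[u [d [h e]]] := valP x.
  exists (u, d); first by rewrite LP.
  by apply: val_inj; rewrite val_trap_posroot.
rewrite (perm_big _ perm) big_map big_mkcond big_allpairs_dep.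
rewrite -(big_mkord xpredT (fun j =>
  \sum_(j <= i < (H - j).+1 | P (trap_posroot i j)) F (trap_posroot i j))).
by apply: eq_bigr => j _; rewrite [RHS]big_mkcond.
Qed.

Lemma chains_above_trap m u d : region u d ->
  chains_above (@rk R r) m (trap_posroot u d) = up_chains H m u d.
Proof.
elim: m u d => [|m IHm] u d h; first exact: chains_above0.
have regP j i : (j <= i < (H - j).+1)%N -> region i j by rewrite /region; lia.
rewrite chains_aboveS sum_posroot /=.
rewrite (big_ord_widen r (fun j =>
    \sum_(j <= i < u.+1) 'X^(H - i - j) * up_chains H m i j)); last first.
  by move: h; rewrite /region /H; lia.
rewrite [RHS]big_mkcond; apply: eq_bigr => j _.
(* Rows with [j > d] contain nothing above [(u, d)]. *)
rewrite ltnS; case: leqP => jd; last first.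
  rewrite big_nat_cond big_pred0 // => i; apply/negbTE/andP => -[/regP h'].
  by rewrite trap_posroot_le // => /andP[_]; rewrite leqNgt jd.
rewrite [RHS](big_nat_widen _ _ (H - j).+1); last by move: h; rewrite /region; lia.
rewrite big_nat_cond [RHS]big_nat_cond; apply: eq_big => [i|i /andP[/regP h' _]].
  by case: (boolP (_ <= i < _)%N) => //= /regP h'; rewrite trap_posroot_le // jd andbT.
by rewrite rk_trap_posroot // IHm.
Qed.

Lemma chain_sum_posroot m : chain_sum (@rk R r) m = trap_chains n m.
Proof.
case: m => [|m]; first exact: chain_sum0.
rewrite chain_sumS sum_posroot; apply: eq_bigr => j _.
apply: eq_big_nat => i ij.
have h : region i j by rewrite /region; lia.
by rewrite rk_trap_posroot // chains_above_trap.
Qed.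

Lemma max_rank_posroot : max_rank (@rk R r) = H.
Proof.
apply/eqP; rewrite eqn_leq; apply/andP; split.
  apply/bigmax_leqP => x _.
  have /mem_positive_rootsP[u [d [h e]]] := valP x.
  have -> : x = trap_posroot u d by apply: val_inj; rewrite val_trap_posroot.
  by rewrite rk_trap_posroot //; lia.
rewrite -[X in (X <= _)%N](subn0 H) -[X in (X - _ <= _)%N](subn0 H).
by rewrite -rk_trap_posroot // leq_bigmax.
Qed.

End RootsB.

(** * The numerator for [r = n.+1] and its specialisations *)

Theorem corollary8p3 (R : realType) (r : nat) (hr : (1 <= r)%N) :
  exists N : {poly {poly int}},
    is_qzeta_numerator (@rk R r) N /\
    N.[1].[1] = ('C(2 * r - 2, r - 1))%:R /\
    size N = ((r - 1).+1)%N /\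
    N`_(r - 1) = 'X^((r - 1) * (r - 2)) /\
    (forall k : nat, (k <= r - 1)%N ->
       (map_poly (fun p : {poly int} => p.[1]) N)`_k
         = ('C(r - 1, k) ^ 2)%N%:R).
Proof.
case: r hr => // n _; rewrite (_ : n.+1 - 1 = n)%N; last exact: subn1.
have Nk k : (\poly_(i < n.+1) trap_numer n i)`_k = trap_numer n k.
  by rewrite coef_poly ltnS; case: leqP => // /trap_numer_gt.
exists (\poly_(k < n.+1) trap_numer n k); split; [|split; [|split; [|split]]].
- move=> k; rewrite Nk /trap_numer /cauchy /numerator_denom max_rank_posroot.
  by rewrite /denom_from big_mkord; apply: eq_bigr => i _; rewrite chain_sum_posroot.
- rewrite horner_poly horner_sum.
  under eq_bigr do rewrite expr1n mulr1 trap_numer_at1.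
  rewrite -natr_sum (_ : 2 * n.+1 - 2 = n + n)%N; last by lia.
  (* The squares sum by Vandermonde's identity once one factor is reflected to ['C(n, n - i)]. *)
  rewrite -binomial.Vandermonde; congr (_%:R); apply: eq_bigr => i _.
  by rewrite (bin_sub (leq_ord i)) mulnn.
- apply: size_poly_eq; rewrite trap_numer_top.
  by rewrite -size_poly_eq0 size_polyXn.
- by rewrite Nk trap_numer_top; congr ('X^(_ * _)); lia.
move=> k kn; rewrite coef_map_id0 ?horner0 // Nk; exact: trap_numer_at1.
Qed.
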